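(* Let $G$ be a countably infinite amenable cancellative semigroup and let $(F_n)$ be a F{\o}lner sequence in $G$. For any $A\subset G$ and $g\in G$ the following are equivalent: $gA$ is $(F_n)$-normal; $A$ is $(F_n)$-normal; $g^{-1}A$ is $(F_n)$-normal.
   Context: A semigroup $G$ is (two-sided) cancellative if $ab=ac\Rightarrow b=c$ and $ba=ca\Rightarrow b=c$. For $g\in G$, $F\subset G$: $gF=\{gh:h\in F\}$ and $g^{-1}F=\{h\in G: gh\in F\}$. A sequence $(F_n)$ of (nonempty) finite subsets of $G$ is a (left) F{\o}lner sequence if $\lim_n |F_n\cap g^{-1}F_n|/|F_n|=1$ for every $g\in G$. Amenable means (left) amenable (for such $G$: a left F{\o}lner sequence exists). For nonempty finite $K\subset G$, $B\in\{0,1\}^K$, $x\in\{0,1\}^G$ and finite $F\subset G$ put $\mathsf N(B,x,F)=|\{g\in G\cup\{e\}: (\forall h\in K)\ hg\in F\text{ and }x_{hg}=B(h)\}|$, where $e$ is a formal identity added if $G$ lacks one. An element $x\in\{0,1\}^G$ is $(F_n)$-normal if $\lim_n\frac1{|F_n|}\mathsf N(B,x,F_n)=2^{-|K|}$ for every nonempty finite $K\subset G$ and every $B\in\{0,1\}^K$; a set $A\subset G$ is $(F_n)$-normal if its indicator function $\mathbf 1_A$ is. *)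

(* Defs.v *)
From HB Require Import structures.
From mathcomp Require Import all_boot all_order all_algebra finmap.
From mathcomp Require Import all_classical all_reals all_analysis.

Set Implicit Arguments.
Unset Strict Implicit.
Unset Printing Implicit Defensive.

Import Order.TTheory GRing.Theory Num.Theory.
Import numFieldNormedType.Exports.

Local Open Scope classical_set_scope.
Local Open Scope fset_scope.
Local Open Scope ring_scope.

Section Semigroup.
Variable G : semigroupType.

Definition cancellative : Prop :=
  (forall a b c : G, (a * b)%g = (a * c)%g -> b = c) /\
  (forall a b c : G, (b * a)%g = (c * a)%g -> b = c).

Definition has_identity : Prop :=
  exists e : G, forall g : G, (e * g)%g = g /\ (g * e)%g = g.

(* gA *)
Definition ltranslate (g : G) (A : set G) : set G :=
  [set (g * h)%g | h in A].

(* g^{-1}A; it makes sense although g need not be invertible *)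
Definition lpreimage (g : G) (A : set G) : set G :=
  [set h | A (g * h)%g].

(* right multiplication of h by an element of G with a formal identity None
   adjoined *)
Definition mulo (h : G) (o : option G) : G :=
  if o is Some g then (h * g)%g else h.

(* The elements counted by N(B,x,F).  The formal identity None is admitted only
   when G has no identity, so that an identity is never counted twice. *)
Definition occurrences (K : {fset G}) (B : {ffun K -> bool}) (x : G -> bool)
    (F : {fset G}) : set (option G) :=
  [set o | (o = None -> ~ has_identity) /\
           forall h : K, mulo (val h) o \in F /\ x (mulo (val h) o) = B h].

(* fset_set maps infinite sets to the empty one; this never happens here when
   G is cancellative and K is nonempty, as o |-> mulo h o is then injective on
   the elements counted. *)
Definition noccurrences (K : {fset G}) (B : {ffun K -> bool}) (x : G -> bool)
    (F : {fset G}) : nat :=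
  #|` fset_set (occurrences B x F)|.

Variable R : realType.

Definition folner_sequence (F : nat -> {fset G}) : Prop :=
  (forall n, F n != fset0) /\
  forall g : G,
    (fun n => #|` [fset h in F n | h \in lpreimage g [set` F n]] |%:R
              / #|` F n|%:R : R) @ \oo --> (1 : R).

(* Left amenability, by means of Folner sequences: for countable cancellative
   semigroups this is the existence of a left-invariant mean. *)
Definition amenable : Prop := exists F : nat -> {fset G}, folner_sequence F.

Definition normal_element (F : nat -> {fset G}) (x : G -> bool) : Prop :=
  forall (K : {fset G}) (B : {ffun K -> bool}), K != fset0 ->
    (fun n => (noccurrences B x (F n))%:R / #|` F n|%:R : R) @ \oo
      --> (2 ^- #|` K| : R).

Definition normal_set (F : nat -> {fset G}) (A : set G) : Prop :=
  normal_element F (fun h => h \in A).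

End Semigroup.

Arguments amenable : clear implicits.
Arguments cancellative : clear implicits.
Arguments has_identity : clear implicits.
Arguments folner_sequence {G} R F.
Arguments normal_element {G} R F x.
Arguments normal_set {G} R F A.

(* Main.v *)
Require Import Defs.
From HB Require Import structures.
From mathcomp Require Import all_boot all_order all_algebra finmap.
From mathcomp Require Import all_classical all_reals all_analysis.

Local Open Scope classical_set_scope.
Local Open Scope card_scope.

(** Passing from [A] to [g^-1 A] changes the indicator [x] into
    [y h = x (g h)], and passing from [g A] to [A] is the same operation, since
    [g^-1 (g A) = A] by left cancellation.  So it is enough to show that [x] is
    normal if and only if [y] is.

    Along a Folner sequence the quantity [N(B,x,F)] may be replaced by the
    number of [f] in [F] with [x (h f) = B h] for all [h] in [K], without asking
    that the elements [h f] lie in [F]: the two counts differ by at most the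
    total number of [f] in [F] that some [h] in [K] moves out of [F], which is
    [o(|F|)] ([noccurrences_le_hits], [hits_le_noccurrences]).  Normality thus
    becomes a statement about densities of sets of elements, and such densities
    are invariant under [f |-> u f] ([has_density_shift]).

    If [x] is normal then so is [y], because the pattern [B] on [K] occurs in
    [y] exactly where the translated pattern on [g K] occurs in [x].
    Conversely, a pattern on an arbitrary [K] has to be moved into [g G].
    The set [g G] has density one, hence so has each preimage [h^-1 g G], and
    therefore some [u] satisfies [h u = g k_h] for all [h] in [K] at once
    ([common_right_multiple]).  By shift invariance the density of the [f] with
    [x (h f) = B h] is that of the [f] with
    [x (h u f) = x (g k_h f) = y (k_h f) = B h], and this is a pattern for [y]
    on the elements [k_h], which are distinct by right cancellation. *)

Section Density.
Set Implicit Arguments.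
Unset Strict Implicit.
Unset Printing Implicit Defensive.
Import Order.TTheory GRing.Theory Num.Theory numFieldNormedType.Exports.
Local Open Scope fset_scope.
Local Open Scope ring_scope.
Variables (R : realType) (G : semigroupType).
Implicit Types (F : {fset G}) (P : pred G) (g h u f : G) (a b e : nat -> nat).

(** * Counting in one finite set *)

Definition hits P F : {fset G} := [fset f in F | P f].

Definition escape h F : {fset G} := hits (fun f => (h * f)%g \notin F) F.

Definition missed h F : {fset G} := F `\` [fset (h * f)%g | f in F].

Lemma card_fset_image (S T : choiceType) (k : S -> T) (X : {fset S}) :
  {in X &, injective k} -> #|` [fset k s | s in X]| = #|` X|.
Proof. by move=> k_inj; rewrite card_in_imfset. Qed.

Lemma card_fset_image_inj (S T : choiceType) (k : S -> T) (X : {fset S}) :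
  injective k -> #|` [fset k s | s in X]| = #|` X|.
Proof. by move=> k_inj; apply: card_fset_image => s t _ _ /k_inj. Qed.

Lemma in_hits P F f : (f \in hits P F) = (f \in F) && P f.
Proof. by rewrite !inE. Qed.

Lemma hits_sub P F : hits P F `<=` F.
Proof. by apply/fsubsetP => f; rewrite in_hits => /andP[]. Qed.

Lemma card_hits_predC P F :
  (#|` hits (predC P) F| = #|` F| - #|` hits P F|)%N.
Proof.
rewrite -(cardfsDS (hits_sub P F)); congr #|` _|; apply/fsetP => f.
by rewrite in_fsetD !in_hits /=; case: (f \in F) => //=; rewrite andbT.
Qed.

Section Cancellative.
Hypothesis G_canc : cancellative G.

Lemma mulgl_inj h : injective (fun f : G => (h * f)%g).
Proof. by move=> f f'; apply: (proj1 G_canc). Qed.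

Lemma mulgr_inj h : injective (fun f : G => (f * h)%g).
Proof. by move=> f f'; apply: (proj2 G_canc). Qed.

(** In a cancellative semigroup a single equation [h = h u] makes [u] a
    two-sided identity.  This is why the formal identity, when it is adjoined,
    does not spoil the injectivity of [o |-> h o]. *)
Lemma absorbing_identity h u : h = (h * u)%g -> has_identity G.
Proof.
move=> hu; have uk k : (u * k)%g = k by apply: (@mulgl_inj h); rewrite mulgA -hu.
exists u => k; split; first exact: uk.
by apply: (@mulgr_inj u); rewrite -mulgA uk.
Qed.

(** As [h] acts injectively, the part of [F] that it moves out leaves a gap of
    the same size in [F]. *)
Lemma card_missed h F : #|` missed h F| = #|` escape h F|.
Proof.
pose stay := hits (fun f => (h * f)%g \in F) F.
rewrite /escape (card_hits_predC (fun f => (h * f)%g \in F)).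
rewrite /missed cardfsD; congr (_ - _)%N.
rewrite -[RHS](card_fset_image_inj _ (@mulgl_inj h)); congr #|` _|; apply/fsetP => k.
apply/fsetIP/imfsetP => [[kF /imfsetP[f /= fF kE]]|[f /=]].
  by exists f => //; rewrite /= in_hits fF -kE.
by rewrite in_hits => /andP[fF hfF] ->; split=> //; apply/imfsetP; exists f.
Qed.

(** Multiplication by [u] maps the [f] in [F] with [P (u f)] injectively to
    elements satisfying [P], and those which land outside [F] are escapes.  The
    next lemma is the reverse comparison: an element of [F] satisfying [P] has
    the form [u f] with [f] in [F], unless it is missed by [u]. *)
Lemma leq_card_hits_shift u P F :
  (#|` hits (fun f => P (u * f)%g) F| <= #|` hits P F| + #|` escape u F|)%N.
Proof.
rewrite -(card_fset_image_inj (hits _ _) (@mulgl_inj u)).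
rewrite -(cardfsID F [fset (u * f)%g | f in _]) leq_add //.
  apply: fsubset_leq_card; apply/fsubsetP => k /fsetIP[/imfsetP[f /=]].
  by rewrite !in_hits => /andP[_ Puf] -> ->.
rewrite -(card_fset_image_inj (escape _ _) (@mulgl_inj u)).
apply: fsubset_leq_card; apply/fsubsetP => k /fsetDP[/imfsetP[f /=]].
rewrite in_hits => /andP[fF _] -> ufF.
by apply/imfsetP; exists f => //; rewrite /= in_hits fF.
Qed.

Lemma leq_card_hits_unshift u P F :
  (#|` hits P F| <= #|` hits (fun f => P (u * f)%g) F| + #|` escape u F|)%N.
Proof.
rewrite -card_missed -(card_fset_image_inj (hits (fun f => P (u * f)%g) _) (@mulgl_inj u)).
apply: leq_trans (leq_card_fsetU _ _).1; apply: fsubset_leq_card.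
apply/fsubsetP => k; rewrite in_hits => /andP[kF Pk]; apply/fsetUP.
have [/imfsetP[f /= fF kE]|kN] := boolP (k \in [fset (u * f)%g | f in F]).
  by left; apply/imfsetP; exists f => //; rewrite /= in_hits fF -kE.
by right; apply/fsetDP.
Qed.

Lemma mulo_inj h (o o' : option G) :
  (o = None -> ~ has_identity G) -> (o' = None -> ~ has_identity G) ->
  Defs.mulo h o = Defs.mulo h o' -> o = o'.
Proof.
case: o o' => [f|] [f'|] //= noid noid' E; first by rewrite (mulgl_inj E).
- by case: (noid' erefl); apply: (@absorbing_identity h f).
- by case: (noid erefl); apply: (@absorbing_identity h f').
Qed.

End Cancellative.

(** * Occurrences of a block *)

Lemma leq_card_hits_has (I : Type) (s : seq I) (P : I -> pred G) F :
  (#|` hits (fun f => has (P^~ f) s) F| <= \sum_(i <- s) #|` hits (P i) F|)%N.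
Proof.
elim: s => [|i s IHs].
  rewrite big_nil leqn0 cardfs_eq0; apply/eqP/fsetP => f.
  by rewrite in_hits andbF in_fset0.
rewrite big_cons; apply: leq_trans (leq_add (leqnn _) IHs).
apply: leq_trans (leq_card_fsetU _ _).1; apply: fsubset_leq_card.
by apply/fsubsetP => f; rewrite in_fsetU !in_hits /= andb_orr.
Qed.

Lemma leq_card_hits_exists (I : finType) (P : I -> pred G) F :
  (#|` hits (fun f => [exists i, P i f]) F| <= \sum_i #|` hits (P i) F|)%N.
Proof.
apply: leq_trans (leq_card_hits_has _ _ _); apply: fsubset_leq_card.
apply/fsubsetP => f; rewrite !in_hits => /andP[-> /existsP[i Pif]] /=.
by apply/hasP; exists i => //; apply: mem_index_enum.
Qed.

(** The block is indexed by an arbitrary finite type through [phi], so that it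
    can be moved to another set of positions by changing [phi] alone. *)
Definition pattern (I : finType) (x : G -> bool) (phi : I -> G) (b : I -> bool)
  : pred G := fun f => [forall i, x (phi i * f)%g == b i].

Section Occurrences.
Hypothesis G_canc : cancellative G.
Variables (K : {fset G}) (B : {ffun K -> bool}) (x : G -> bool) (F : {fset G}).

Lemma occurrences_finite : K != fset0 -> finite_set (occurrences B x F).
Proof.
move=> /fset0Pn[h hK].
(* Besides [None], an occurrence is some [f] with [h f] in [F]. *)
have fin_h : finite_set ((fun f => (h * f)%g) @^-1` [set` F]).
  apply: finite_preimage; last exact: finite_fset.
  by move=> f f' _ _ /(mulgl_inj G_canc).
apply: (@sub_finite_set _ _ (None |` Some @` ((fun f => (h * f)%g) @^-1` [set` F]))).
  move=> [f|] [_ occ]; last by left.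
  by right; exists f => //; have [] := occ [` hK].
by rewrite finite_setU; split; [exact: finite_set1|exact: finite_image].
Qed.

Let occ := fset_set (occurrences B x F).

(** An occurrence [o] is determined by the element [h o] of [F].  If that
    element is [h f] with [f] in [F], then [o] is [f] and is counted on the
    right; otherwise [h o] is missed by [h].  The formal identity, when
    counted, always falls in the second case. *)
Lemma noccurrences_le_hits (h : K) :
  (noccurrences B x F <=
     #|` hits (pattern x val B) F| + #|` escape (val h) F|)%N.
Proof.
have K0 : K != fset0 by apply/fset0Pn; exists (val h); apply: valP.
have occP o : o \in occ -> occurrences B x F o.
  by rewrite in_fset_set ?inE//; apply: occurrences_finite.
rewrite -(card_missed G_canc).
rewrite -(card_fset_image_inj (hits _ _) (@mulgl_inj G_canc (val h))).
rewrite /noccurrences -/occ -(@card_fset_image _ _ (Defs.mulo (val h)) occ); last first.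
  by move=> o o' /occP[nid _] /occP[nid' _]; apply: (mulo_inj G_canc).
apply: leq_trans (leq_card_fsetU _ _).1; apply: fsubset_leq_card.
apply/fsubsetP => k /imfsetP[ o /= /occP[nid oB] ->]; apply/fsetUP.
have [/imfsetP[f /= fF kE]|kN] :=
    boolP (Defs.mulo (val h) o \in [fset (val h * f)%g | f in F]); last first.
  by right; apply/fsetDP; split=> //; have [] := oB h.
have oE : o = Some f by apply: (mulo_inj G_canc (h := val h)).
left; apply/imfsetP; exists f => //=; rewrite in_hits fF /=.
by apply/forallP => i; have [_] := oB i; rewrite oE /= => ->.
Qed.

(** A hit [f] fails to be an occurrence only when some [h] in [K] moves [f] out
    of [F]. *)
Lemma hits_le_noccurrences : K != fset0 ->
  (#|` hits (pattern x val B) F| <=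
     noccurrences B x F + \sum_(h : K) #|` escape (val h) F|)%N.
Proof.
move=> K0; pose inside f := [forall h : K, (val h * f)%g \in F].
rewrite -(cardfsID [fset f in F | inside f]) leq_add //.
  rewrite -(card_fset_image_inj _ (@Some_inj _ : injective (@Some G))).
  apply: fsubset_leq_card; apply/fsubsetP => _ /imfsetP[f /= + ->].
  rewrite in_fsetI in_hits !inE => /andP[/andP[fF /forallP fB] /andP[_ /forallP ins]].
  rewrite in_fset_set; last by apply: occurrences_finite.
  rewrite inE.
  by split=> // h; split; [exact: ins|by apply/eqP/fB].
apply: leq_trans (leq_card_hits_exists _ _); apply: fsubset_leq_card.
apply/fsubsetP => f; rewrite in_fsetD !in_hits.
by case/and3P => + fF _; rewrite fF /= => /forallPn[h hN]; apply/existsP; exists h.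
Qed.

End Occurrences.

(** * Densities along a Folner sequence *)

Definition negligible (F : nat -> {fset G}) e :=
  (fun n => (e n)%:R / #|` F n|%:R : R) @ \oo --> (0 : R).

Definition has_density (F : nat -> {fset G}) P (l : R) :=
  (fun n => #|` hits P (F n)|%:R / #|` F n|%:R : R) @ \oo --> l.

Section Limits.
Variable F : nat -> {fset G}.

Lemma negligible_sum (I : finType) (e : I -> nat -> nat) :
  (forall i, negligible F (e i)) -> negligible F (fun n => \sum_i e i n)%N.
Proof.
move=> e0; rewrite /negligible.
under eq_fun do rewrite natr_sum mulr_suml.
suff : (fun n => \sum_i ((e i n)%:R / #|` F n|%:R)) @ \oo --> \sum_(i : I) (0 : R).
  by rewrite big1.
apply: cvg_big => [z|i _]; last exact: e0.
by apply: cvgD; [exact: cvg_fst|exact: cvg_snd].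
Qed.

Lemma negligible_le a e :
  (forall n, a n <= e n)%N -> negligible F e -> negligible F a.
Proof.
move=> ae; apply: (squeeze_cvgr _ (cvg_cst 0)); near=> n.
by rewrite divr_ge0 //= ler_wpM2r ?invr_ge0 // ler_nat.
Unshelve. all: by end_near. Qed.

Lemma proportion_cvg a b e (l : R) : negligible F e ->
  (forall n, a n <= b n + e n)%N -> (forall n, b n <= a n + e n)%N ->
  (fun n => (a n)%:R / #|` F n|%:R : R) @ \oo --> l ->
  (fun n => (b n)%:R / #|` F n|%:R : R) @ \oo --> l.
Proof.
move=> e0 abe bae al.
have lo := cvgB al e0; have hi := cvgD al e0; rewrite subr0 in lo.
rewrite addr0 in hi.
apply: (squeeze_cvgr _ (lo _) (hi _)); near=> n.
rewrite /= !fctE -mulrBl -mulrDl !ler_wpM2r ?invr_ge0 //=.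
  by rewrite -natrD ler_nat.
by rewrite lerBlDr -natrD ler_nat.
Unshelve. all: by end_near. Qed.

Hypothesis G_canc : cancellative G.
Hypothesis F_folner : folner_sequence R F.

Lemma folner_escape h : negligible F (fun n => #|` escape h (F n)|).
Proof.
have [F0 Fh] := F_folner; have := cvgB (cvg_cst (1 : R)) (Fh h).
move=> /(_ eventually_filter eventually_filter); rewrite subrr /negligible.
suff -> : (fun n => #|` escape h (F n)|%:R / #|` F n|%:R : R) =
  (fun=> 1) - (fun n => #|` [fset f in F n | f \in lpreimage h [set` F n]]|%:R
                 / #|` F n|%:R : R) by [].
apply/funext => n.
rewrite /= fctE /escape (card_hits_predC (fun f => (h * f)%g \in F n)).
have Fn0 : #|` F n|%:R != 0 :> R by rewrite pnatr_eq0 cardfs_eq0.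
rewrite natrB ?fsubset_leq_card ?hits_sub // mulrBl divff //.
congr (_ - _%:R / _); congr #|` _|; apply/fsetP => f.
by rewrite in_hits !inE; congr (_ && _); apply/idP/idP; rewrite inE.
Qed.

(** Densities are left invariant, since both comparisons between [P] and its
    shift have the number of escapes of [u] as error. *)
Lemma has_density_shift u P l :
  has_density F (fun f => P (u * f)%g) l <-> has_density F P l.
Proof.
by split; apply: proportion_cvg (folner_escape u) _ _ => n;
  do ?[exact: leq_card_hits_shift|exact: leq_card_hits_unshift].
Qed.

Lemma negligible_exists (P : pred G) : negligible F (fun n => #|` hits P (F n)|) ->
  exists u, ~~ P u.
Proof.
move=> P0; apply: contrapT => allP; have [F0 _] := F_folner.
have one : (fun n => #|` hits P (F n)|%:R / #|` F n|%:R : R) = fun=> 1.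
  apply/funext => n.
  rewrite (_ : hits P (F n) = F n) ?divff ?pnatr_eq0 ?cardfs_eq0 //.
  apply/fsetP => f; rewrite in_hits; case: (f \in F n) => //=.
  by apply/negPn/negP => Pf; apply: allP; exists f.
move: P0; rewrite /negligible one => /(cvg_lim (@Rhausdorff R)).
by rewrite lim_cst // => /eqP; rewrite oner_eq0.
Qed.

(** A finite form of the Ore condition: an element of [F n] outside [g G] is
    missed by [g], so the complement of [g G] has density zero.  By shift
    invariance so has its preimage under each [phi i], and finitely many sets of
    density zero do not cover [G]. *)
Lemma common_right_multiple (I : finType) (phi : I -> G) g :
  exists u, exists k : I -> G, forall i, (phi i * u)%g = (g * k i)%g.
Proof.
pose offgG f := ~~ `[< exists k, f = (g * k)%g >].
have offgG0 : negligible F (fun n => #|` hits offgG (F n)|).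
  apply: negligible_le (folner_escape g) => n.
  rewrite -(card_missed G_canc); apply: fsubset_leq_card; apply/fsubsetP => f.
  rewrite in_hits => /andP[fF /asboolPn nf]; apply/fsetDP; split=> //.
  by apply/imfsetP => -[k /= _ fE]; apply: nf; exists k.
have bad0 : negligible F (fun n =>
    #|` hits (fun f => [exists i, offgG (phi i * f)%g]) (F n)|).
  apply: (@negligible_le _ (fun n => \sum_i
    #|` hits (fun f => offgG (phi i * f)%g) (F n)|)%N).
    by move=> n; apply: leq_card_hits_exists.
  by apply: negligible_sum => i; apply/(has_density_shift (phi i)).
have [u] := negligible_exists bad0.
rewrite negb_exists => /forallP uP; exists u.
have /choice[k kP] : forall i, exists k, (phi i * u = g * k)%g.
  by move=> i; have := uP i; rewrite negbK => /asboolP.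
by exists k.
Qed.

(** * Normality as a statement on densities *)

Lemma normal_element_density x :
  normal_element R F x <->
  forall (K : {fset G}) (B : {ffun K -> bool}), K != fset0 ->
    has_density F (pattern x val B) (2 ^- #|` K|).
Proof.
have sub (K : {fset G}) : negligible F (fun n => \sum_(h : K) #|` escape (val h) (F n)|)%N.
  by apply: negligible_sum => h; apply: folner_escape.
have le1 (K : {fset G}) (B : {ffun K -> bool}) n : K != fset0 ->
    (noccurrences B x (F n) <= #|` hits (pattern x val B) (F n)| +
       \sum_(h : K) #|` escape (val h) (F n)|)%N.
  move=> /fset0Pn[h hK].
  apply: leq_trans (noccurrences_le_hits G_canc B x (F n) [` hK]) _.
  by rewrite leq_add2l (bigD1 [` hK]) //= leq_addr.
by split=> xn K B K0; apply: proportion_cvg (sub K) _ _ (xn K B K0) => n;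
  do ?[exact: le1|exact: hits_le_noccurrences].
Qed.

(** A block along an injective [phi] is a block on the image of [phi]. *)
Lemma normal_elementP x :
  normal_element R F x <->
  forall (I : finType) (phi : I -> G) (b : I -> bool), (0 < #|I|)%N ->
    injective phi -> has_density F (pattern x phi b) (2 ^- #|I|).
Proof.
rewrite normal_element_density; split=> xn; last first.
  move=> K B K0; rewrite cardfE; apply: xn val_inj.
  by rewrite -cardfE cardfs_gt0.
move=> I phi b I0 phi_inj; pose K := [fset phi i | i in I].
have cK : #|` K| = #|I| by rewrite card_imfset //= -cardE.
(* [B] is [b] composed with the inverse of [phi] on its image [K]. *)
pose B := [ffun k : K => [exists i, (phi i == val k) && b i]].
have /(xn K B) : K != fset0 by rewrite -cardfs_gt0 cK.
rewrite cK (_ : pattern x val B = pattern x phi b) //.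
apply/funext => f; apply/forallP/forallP => [fB i|fb k].
  have iK : phi i \in K by apply/imfsetP; exists i.
  rewrite (eqP (fB [` iK])) ffunE /=; apply/eqP; apply/existsP/idP => [[j]|bi].
    by case/andP => /eqP/phi_inj ->.
  by exists i; rewrite eqxx.
have /imfsetP[i /= _ kE] := valP k; rewrite kE (eqP (fb i)) ffunE.
apply/eqP; apply/idP/existsP => [bi|[j]]; first by exists i; rewrite -kE eqxx.
by rewrite [val k]kE => /andP[/eqP/phi_inj ->].
Qed.

(** From left to right, blocks for the shifted element are blocks for [x] on the
    translated positions [g (phi i)].  From right to left, an Ore multiplier [u]
    brings all positions of a block into [g G]. *)
Lemma normal_element_lshift x g :
  normal_element R F x <-> normal_element R F (fun h => x (g * h)%g).
Proof.
rewrite !normal_elementP; split=> xn I phi b I0 phi_inj.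
  have := xn I (fun i => g * phi i)%g b I0 (inj_comp (@mulgl_inj G_canc g) phi_inj).
  congr (has_density F _ _); apply/funext => f.
  by apply: eq_forallb => i; rewrite mulgA.
have [u [k uk]] := common_right_multiple phi g.
have k_inj : injective k.
  move=> i j kij; apply: phi_inj; apply: (@mulgr_inj G_canc u).
  by rewrite /= !uk kij.
have yd := xn I k b I0 k_inj.
apply/(has_density_shift u); move: yd.
congr (has_density F _ _); apply/funext => f.
by apply: eq_forallb => i; rewrite /= !mulgA uk.
Qed.

End Limits.
End Density.

Theorem theorem3p3 (R : realType) (G : semigroupType)
    (G_countably_infinite : [set: G] #= [set: nat])
    (G_amenable : amenable G R)
    (G_cancellative : cancellative G)
    (F : nat -> {fset G}) (F_folner : folner_sequence R F)
    (A : set G) (g : G) :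
  (normal_set R F (ltranslate g A) <-> normal_set R F A) /\
  (normal_set R F A <-> normal_set R F (lpreimage g A)).
Proof.
have preimage (X : set G) : normal_set R F X <-> normal_set R F (lpreimage g X).
  rewrite /normal_set (normal_element_lshift G_cancellative F_folner _ g).
  by under eq_fun do rewrite -[_ \in X]/(_ \in lpreimage g X).
split; last exact: preimage.
rewrite (preimage (ltranslate g A)) (_ : lpreimage g _ = A) //.
apply/seteqP; split=> [h [k Ak /(proj1 G_cancellative) <-]//|h Ah].
by exists h.
Qed.
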